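(* Let $N$ be a Poisson process on $[0,\infty)$ with intensity $\lambda>0$, with points $0<X_1<X_2<\cdots$, and let $\epsilon>0$. For every $i\ge1$ and every $s\ge 0$, $$\mathbb{E}\left[e^{-sB_i}\right]=\frac{\lambda+s}{\lambda+s\,e^{(\lambda+s)\epsilon}}.$$
   Context: A cluster is a maximal set of consecutive points $X_j,\dots,X_k$ with $X_{l+1}-X_l\le\epsilon$ for $j\le l<k$. Clusters are numbered from left to right; $A_i$ denotes the first point of the $i$-th cluster and $E_i=X_k+\epsilon$, where $X_k$ is the last point of the $i$-th cluster. The length of the $i$-th cluster is $B_i=E_i-A_i$. *)

(* Defs.v *)
From HB Require Import structures.
From mathcomp Require Import all_boot all_order all_algebra.
From mathcomp Require Import finmap.
From mathcomp Require Import all_classical all_reals all_analysis.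
Set Implicit Arguments. Unset Strict Implicit. Unset Printing Implicit Defensive.
Import Order.TTheory GRing.Theory Num.Theory.
Local Open Scope classical_set_scope.
Local Open Scope ring_scope.

(* Points are indexed from 0:  x 0 = X_1, x 1 = X_2, ...  *)
Section clusters.
Variable R : realType.
Implicit Types (x : nat -> R) (eps : R).

(* the gap after the k-th point (0-indexed) exceeds eps, i.e. the point x k
   is the last point of its cluster *)
Definition big_gap x eps : pred nat := fun k => eps < x k.+1 - x k.

(* first index k >= j such that x k is the last point of its cluster;
   (default j if no such index exists -- a null event for a Poisson process) *)
Definition next_end x eps (j : nat) : nat :=
  match pselect (exists k, big_gap x eps (j + k)) with
  | left h => (j + ex_minn h)%N
  | right _ => j
  end.

(* 0-indexed: cluster_start x eps i = index of the first point of the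
   (i+1)-th cluster *)
Fixpoint cluster_start x eps (i : nat) : nat :=
  match i with
  | 0 => 0
  | i.+1 => (next_end x eps (cluster_start x eps i)).+1
  end.

Definition cluster_last x eps (i : nat) : nat :=
  next_end x eps (cluster_start x eps i).

(* Paper's numbering (i >= 1): A_i, E_i, B_i of the i-th cluster. *)
Definition clusterA x eps (i : nat) : R := x (cluster_start x eps i.-1).
Definition clusterE x eps (i : nat) : R := x (cluster_last x eps i.-1) + eps.
Definition clusterB x eps (i : nat) : R := clusterE x eps i - clusterA x eps i.
End clusters.

Section poisson.
Context {d : measure_display} {T : measurableType d} {R : realType}.

Definition mutually_independent (P : probability T R) (Y : nat -> T -> R) :=
  forall (I : {fset nat}) (B : nat -> set R),
    (forall i, i \in I -> measurable (B i)) ->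
    P (\bigcap_(i in [set` I]) (Y i @^-1` B i)) =
    (\prod_(i <- I) P (Y i @^-1` B i))%E.

Definition interarrival (X : nat -> T -> R) (n : nat) : T -> R :=
  fun w => match n with 0 => X 0%N w | m.+1 => X m.+1 w - X m w end.

(* X 0 < X 1 < ... are the points of a homogeneous Poisson process on
   [0, oo) of intensity lam: the inter-arrival times are i.i.d. Exp(lam) *)
Definition poisson_process (P : probability T R) (lam : R)
    (X : nat -> T -> R) :=
  (forall n, measurable_fun setT (X n)) /\
  (forall n (B : set R), measurable B ->
     P (interarrival X n @^-1` B) = exponential_prob lam B) /\
  mutually_independent P (interarrival X).
End poisson.

(* Main.v *)
(* The first point of a cluster is a stopping time for the i.i.d. exponential gaps:
   whether the i-th cluster starts at the point c depends on the gaps up to that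
   point only, so the later gaps are still i.i.d. given this event. The cluster
   ends k points further when the next k gaps are at most eps and the following
   one exceeds eps, which contributes (E[exp(-s G); G <= eps])^k P(G > eps)
   exp(-s eps) to the transform. Summing the geometric series over k, then over c,
   gives the formula. The convention for a last, infinite cluster only affects a
   null event. *)

Require Import Defs.
From mathcomp Require Import all_boot all_order all_algebra finmap.
From mathcomp Require Import all_classical all_reals all_analysis.
From mathcomp Require Import measurable_realfun ring.
Import Order.TTheory GRing.Theory Num.Theory.
Local Open Scope classical_set_scope.
Local Open Scope ring_scope.
Import HBNNSimple.

Set Implicit Arguments. Unset Strict Implicit. Unset Printing Implicit Defensive.

(** * Change of variables for nonnegative integrands *)

(* With [c = 1] and [Z = 1] this is integration against a law, with [Y = id]
   integration against a density; the constant [c] makes it apply to a [Z]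
   independent of [Y], where [c] is the mean of [Z]. *)
Lemma ge0_integral_transport (d1 d2 : measure_display) (T : measurableType d1)
  (U : measurableType d2) (R : realType) (mu : {measure set T -> \bar R})
  (nu : {measure set U -> \bar R}) (c : R) (Y : T -> U) (Z : T -> R)
  (f : U -> R) :
  0 <= c -> measurable_fun setT Y -> measurable_fun setT Z ->
  (forall w, 0 <= Z w) ->
  (forall B, measurable B ->
    (c%:E * nu B = \int[mu]_(w in Y @^-1` B) (Z w)%:E)%E) ->
  measurable_fun setT f -> (forall x, 0 <= f x) ->
  (c%:E * \int[nu]_x (f x)%:E = \int[mu]_w (f (Y w) * Z w)%:E)%E.
Proof.
move=> c0 mY mZ Z0 cZ mf f0.
have mEf : measurable_fun setT (EFin \o f) by exact/measurable_EFinP.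
have Ef0 x : setT x -> (0 <= (EFin \o f) x)%E by move=> _; rewrite lee_fin.
(* The hypothesis [cZ] is the identity for indicators. It extends by linearity to the simple
   functions [h n], then to [f] by monotone convergence on both sides. *)
pose h := nnsfun_approx measurableT mEf.
have h0 n x : (0 <= (h n x)%:E)%E by rewrite lee_fin.
have hf x : ((h n x)%:E @[n --> \oo] --> (f x)%:E)%classic.
  exact: cvg_nnsfun_approx.
have mh n : measurable_fun setT (h n) by exact/measurable_funP.
have step n : (c%:E * \int[nu]_x (h n x)%:E
    = \int[mu]_w ((h n (Y w))%:E * (Z w)%:E))%E.
  have hE x : ((h n x)%:E =
      \sum_(y \in range (h n)) (y%:E * (\1_(h n @^-1` [set y]) x)%:E))%E.
    by rewrite fimfunE -fsumEFin.
  under [RHS]eq_integral => w _.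
    rewrite hE ge0_mule_fsuml; last by move=> y; exact: nnfun_muleindic_ge0.
    over.
  under [X in (_ * X)%E = _]eq_integral => x _ do rewrite hE.
  have mind r : measurable_fun setT (\1_(h n @^-1` [set r]) : U -> R).
    by apply: measurable_indic; exact: measurable_sfunP.
  rewrite !ge0_integral_fsum//; first last.
  - by move=> r x _; exact: nnfun_muleindic_ge0.
  - move=> r; apply/measurable_EFinP; exact: measurable_funM.
  - move=> r w _; apply: mule_ge0; [exact: nnfun_muleindic_ge0|by rewrite lee_fin].
  - move=> r; apply/measurable_EFinP; apply: measurable_funM => //.
    apply: measurable_funM => //.
    exact: (measurableT_comp (mind r) mY).
  rewrite ge0_mule_fsumr; last first.
    by move=> r; apply: integral_ge0 => x _; exact: nnfun_muleindic_ge0.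
  apply: eq_fsbigr => r /set_mem[x _ <-].
  set A := h n @^-1` _.
  have mA : measurable A by exact: measurable_sfunP.
  have mYA : measurable (Y @^-1` A) by rewrite -[X in measurable X]setTI; exact: mY.
  under [RHS]eq_integral do rewrite -muleA.
  rewrite !ge0_integralZl_EFin ?integral_indic ?setIT//.
  - rewrite muleCA cZ// [in LHS]integral_mkcond epatch_indic.
    by congr (_ * _)%E; apply: eq_integral => w _; rewrite muleC.
  - by move=> w _; rewrite mule_ge0 ?lee_fin.
  - apply/measurable_EFinP; apply: measurable_funM => //.
    exact: (measurableT_comp (mind _) mY).
  - exact/measurable_EFinP.
have mono x m k : (m <= k)%N -> ((h m x)%:E <= (h k x)%:E)%E.
  by move=> mk; rewrite lee_fin; exact/lefP/nd_nnsfun_approx.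
have lhs : (c%:E * \int[nu]_x (h n x)%:E @[n --> \oo] -->
    c%:E * \int[nu]_x (f x)%:E)%E.
  apply: cvgeZl => //.
  under eq_integral => x _ do rewrite -(cvg_lim _ (hf x))//.
  apply: cvg_monotone_convergence => //.
  - by move=> n; exact/measurable_EFinP.
  - by move=> x _ m k; exact: mono.
have rhs : (\int[mu]_w ((h n (Y w))%:E * (Z w)%:E) @[n --> \oo] -->
    \int[mu]_w (f (Y w) * Z w)%:E)%E.
  have hZ w : ((h n (Y w))%:E * (Z w)%:E @[n --> \oo] --> (f (Y w) * Z w)%:E)%E.
    by rewrite EFinM; apply: cvgeZr.
  under eq_integral => w _ do rewrite -(cvg_lim _ (hZ w))//.
  apply: cvg_monotone_convergence => //.
  - move=> n; apply/measurable_EFinP; apply: measurable_funM => //.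
    exact: (measurableT_comp (mh n) mY).
  - by move=> n w _; rewrite mule_ge0 ?lee_fin.
  - by move=> w _ m k mk; rewrite lee_wpmul2r ?lee_fin//; exact: mono.
move: lhs; under eq_fun do rewrite step.
by move=> lhs; exact: (cvg_unique _ lhs rhs).
Qed.

(** Nonnegativity makes all the integrals meaningful without integrability conditions. Finiteness
    turns products of means into real constants, as required by [ge0_integral_transport] and for
    pulling them out of series. *)
Definition finite_mean (d : measure_display) (T : measurableType d)
  (R : realType) (P : probability T R) (V : T -> R) (h : R -> R) :=
  [/\ measurable_fun setT h, forall x, 0 <= h x &
      (\int[P]_w (h (V w))%:E)%E \is a fin_num].

(** Serves to replace an event defined through [next_end] by a condition on finitely many gaps: the
    two agree off the null event where the default value is taken. *)
Lemma integral_eq_null (d : measure_display) (T : measurableType d)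
  (R : realType) (mu : {measure set T -> \bar R}) (A B N : set T) (h : T -> R) :
  measurable A -> measurable B -> measurable N -> mu N = 0 ->
  A `\` N = B `\` N -> measurable_fun setT h -> (forall w, 0 <= h w) ->
  (\int[mu]_(w in A) (h w)%:E = \int[mu]_(w in B) (h w)%:E)%E.
Proof.
move=> mA mB mN N0 AB mh h0.
have mEh D : measurable_fun D (EFin \o h).
  by apply: measurable_funTS; exact/measurable_EFinP.
rewrite (ge0_negligible_integral mN)//; last by move=> w _; rewrite lee_fin.
rewrite [RHS](ge0_negligible_integral mN)// ?AB//.
by move=> w _; rewrite lee_fin.
Qed.

(** * Independent families and events independent of the future *)

Section independence.
Context (d : measure_display) (T : measurableType d) (R : realType).
Variables (P : probability T R) (Y : nat -> T -> R).
Hypothesis mY : forall m, measurable_fun setT (Y m).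
Implicit Types (f : nat -> R -> R) (s : seq nat).

Lemma measurable_preimage m (B : set R) :
  measurable B -> measurable (Y m @^-1` B).
Proof. by move=> mB; rewrite -[X in measurable X]setTI; exact: mY. Qed.

Lemma integral_indic_preimage m (B : set R) : measurable B ->
  (\int[P]_w (\1_B (Y m w))%:E = P (Y m @^-1` B))%E.
Proof.
move=> mB; rewrite -[X in P X]setIT -integral_indic//.
exact: measurable_preimage.
Qed.

Lemma finite_mean_indic m (B : set R) :
  measurable B -> finite_mean P (Y m) (\1_B : R -> R).
Proof.
move=> mB; split; first exact: measurable_indic.
  by move=> x; rewrite indicE ler0n.
by rewrite integral_indic_preimage// fin_num_measure//; exact: measurable_preimage.
Qed.

Lemma finite_mean1 m : finite_mean P (Y m) (cst 1).
Proof. by rewrite -indicT; exact: finite_mean_indic. Qed.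

Lemma finite_meanM_indic m (h : R -> R) (B : set R) : measurable B ->
  finite_mean P (Y m) h -> finite_mean P (Y m) (fun x => h x * \1_B x).
Proof.
move=> mB [mh h0 fh]; have mhB : measurable_fun setT (fun x => h x * \1_B x).
  by apply: measurable_funM => //; exact: measurable_indic.
have hB0 x : 0 <= h x * \1_B x by rewrite mulr_ge0// indicE ler0n.
split => //; rewrite ge0_fin_numE; last first.
  by apply: integral_ge0 => w _; rewrite lee_fin.
move: fh; rewrite ge0_fin_numE; last first.
  by apply: integral_ge0 => w _; rewrite lee_fin.
apply: le_lt_trans; apply: ge0_le_integral => //.
- by move=> w _; rewrite lee_fin.
- exact/measurable_EFinP/(measurableT_comp mhB (mY m)).
- exact/measurable_EFinP/(measurableT_comp mh (mY m)).
- move=> w _; rewrite lee_fin ler_piMr// indicE lern1; exact: leq_b1.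
Qed.

Lemma measurable_prod_comp s f : (forall m, finite_mean P (Y m) (f m)) ->
  measurable_fun setT (fun w => \prod_(m <- s) f m (Y m w)).
Proof.
move=> uf; apply: measurable_prod => m _; case: (uf m) => mf _ _.
exact: (measurableT_comp mf (mY m)).
Qed.

Lemma prod_comp_ge0 s f w : (forall m, finite_mean P (Y m) (f m)) ->
  0 <= \prod_(m <- s) f m (Y m w).
Proof. by move=> uf; apply: prodr_ge0 => m _; case: (uf m). Qed.

Hypothesis iY : mutually_independent P Y.

(* Induction on [k]: the factors of index at least [k] are indicators, and the
   transport lemma frees one more factor at each step. *)
Lemma independent_prod s f : uniq s -> (forall m, finite_mean P (Y m) (f m)) ->
  (\int[P]_w (\prod_(m <- s) f m (Y m w))%:E =
   \prod_(m <- s) \int[P]_w (f m (Y m w))%:E)%E.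
Proof.
move=> us uf.
suff H k : forall (g : nat -> R -> R) (B : nat -> set R),
    (forall m, finite_mean P (Y m) (g m)) -> (forall m, measurable (B m)) ->
    (forall m, m \in s -> (k <= m)%N -> g m = \1_(B m)) ->
    (\int[P]_w (\prod_(m <- s) g m (Y m w))%:E =
     \prod_(m <- s) \int[P]_w (g m (Y m w))%:E)%E.
  (* With [k] beyond every index in [s], no factor has to be an indicator, so the sets are
     arbitrary. *)
  apply: (H (\max_(m <- s) m).+1 f (fun=> set0)) => // m ms.
  by rewrite ltnNge (@leq_bigmax_seq _ s xpredT id m).
elim: k => [g B ug mB gB|k IH g B ug mB gB].
  (* For [k = 0] every factor is an indicator, and their product is the indicator of the
     intersection that occurs in [mutually_independent]. *)
  have mYB m : measurable (Y m @^-1` B m) by exact: measurable_preimage.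
  have [I IE Is] : exists2 I : {fset nat}, I =i s & perm_eq I s.
    exists (seq_fset tt s); first exact: seq_fsetE.
    by rewrite -[X in perm_eq _ X]undup_id//; exact: seq_fset_perm.
  transitivity (P (\bigcap_(i in [set` I]) (Y i @^-1` B i))).
    rewrite -[X in _ = P X]setIT -integral_indic//; last first.
      by apply: bigcap_measurableType => //.
    apply: eq_integral => w _; congr (_%:E).
    rewrite indicE; case: (boolP (_ \in _)) => [/set_mem wB|wB].
      rewrite big_seq big1// => m ms; rewrite gB// indicE mem_set//.
      by apply: wB; rewrite /= IE.
    have [m ms wm] : exists2 m, m \in s & ~ B m (Y m w).
      apply: contrapT => h; move/negP: wB; apply; apply/mem_set => m /=.
      by rewrite IE => ms; apply: contrapT => nB; apply: h; exists m.
    by rewrite (bigD1_seq m)//= gB// indicE memNset// mul0r.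
  rewrite iY; last by move=> m _; exact: mB.
  rewrite (perm_big _ Is).
  apply: eq_big_seq => m ms; rewrite gB//.
  by rewrite integral_indic_preimage.
have [ks|ks] := boolP (k \in s); last first.
  apply: (IH _ B) => // m ms km; apply: gB => //.
  by rewrite ltn_neqAle km andbT; apply: contraNneq ks => ->.
pose c := (\prod_(m <- s | m != k) \int[P]_w (g m (Y m w))%:E)%E.
have cfin : c \is a fin_num.
  by apply: prode_fin_num => m _; case: (ug m).
have gge0 m x : 0 <= g m x by case: (ug m).
have c0 : (0 <= c)%E.
  by apply: prode_ge0 => m _; apply: integral_ge0 => w _; rewrite lee_fin.
pose Z w := \prod_(m <- s | m != k) g m (Y m w).
have mZ : measurable_fun setT Z.
  rewrite /Z; under eq_fun do rewrite -big_filter.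
  exact: measurable_prod_comp.
have Z0 w : 0 <= Z w by apply: prodr_ge0 => m _.
rewrite (bigD1_seq k)//= -/c muleC -(fineK cfin).
under eq_integral => w _ do rewrite (bigD1_seq k)//= -/(Z w).
have mYk := mY k.
rewrite -(ge0_integral_transport (nu := pushforward P (Y k)) (c := fine c))//.
- congr (_ * _)%E; rewrite (ge0_integral_pushforward mYk)//.
  + by apply/measurable_EFinP; case: (ug k).
  + by move=> x _; rewrite lee_fin.
- exact: fine_ge0.
- move=> C mC; rewrite fineK//.
  (* Once the factor of index [k] is replaced by the indicator of [C], the induction hypothesis
     applies. It says that weighting [P] by [Z] multiplies the law of [Y k] by the constant [c],
     which is what the transport requires. *)
  pose g' m := if m == k then \1_C else g m.
  have ug' m : finite_mean P (Y m) (g' m).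
    by rewrite /g'; case: eqP => // ->; exact: finite_mean_indic.
  have mYC : measurable (Y k @^-1` C) by exact: measurable_preimage.
  have g'k : g' k = \1_C by rewrite /g' eqxx.
  have g'm m : m != k -> g' m = g m by rewrite /g' => /negbTE ->.
  have := IH g' (fun m => if m == k then C else B m) ug'.
  rewrite (bigD1_seq k)//= g'k; under eq_bigr => m mk do rewrite g'm//.
  under eq_integral => w _.
    rewrite (bigD1_seq k)//= g'k; under eq_bigr => m mk do rewrite g'm//.
    over.
  rewrite -/c => IHg.
  rewrite muleC /pushforward -[X in P X]setIT -integral_indic// -IHg.
  + rewrite [RHS]integral_mkcond epatch_indic; apply: eq_integral => w _ /=.
    by rewrite mulrC.
  + by move=> m; case: eqP.
  + move=> m ms km; case: eqP => [->|/eqP mk]; [exact: g'k|rewrite g'm//].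
    by apply: gB => //; rewrite ltn_neqAle km andbT eq_sym.
- by case: (ug k).
Qed.

Local Notation mean m h := (\int[P]_w (h (Y m w))%:E)%E.

(* For a family of finite-mean functions, integrating over [A] a product of
   functions of the [Y m] with [c < m] factorizes, i.e. [A] is independent of
   everything that comes after time [c]. *)
Definition indep_future (A : set T) (c : nat) :=
  measurable A /\
  forall n f, (forall m, finite_mean P (Y m) (f m)) ->
    (\int[P]_(w in A) (\prod_(c.+1 <= m < n) f m (Y m w))%:E =
     P A * \prod_(c.+1 <= m < n) mean m (f m))%E.

Lemma indep_futureT c : indep_future setT c.
Proof.
split=> // n f ff; rewrite probability_setT mul1e.
by apply: independent_prod => //; exact: iota_uniq.
Qed.

Lemma indep_future0 c : indep_future set0 c.
Proof. by split=> // n f ff; rewrite integral_set0 measure0 mul0e. Qed.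

Lemma prod_mean_fin_num s f : (forall m, finite_mean P (Y m) (f m)) ->
  (\prod_(m <- s) mean m (f m))%E \is a fin_num.
Proof. by move=> ff; apply: prode_fin_num => m _; case: (ff m). Qed.

(** Both sides of the factorization are countably additive over disjoint events, and the product of
    means is a finite constant that comes out of the series. *)
Lemma indep_future_bigcup (F : nat -> set T) c : trivIset setT F ->
  (forall j, indep_future (F j) c) -> indep_future (\bigcup_j F j) c.
Proof.
move=> tF iF; have mF j : measurable (F j) by case: (iF j).
have mUF : measurable (\bigcup_j F j) by exact: bigcupT_measurable.
split=> // n f ff; rewrite ge0_integral_bigcup//; last 2 first.
- apply/measurable_EFinP; apply: measurable_funTS; exact: measurable_prod_comp.
- by move=> w _; rewrite lee_fin; exact: prod_comp_ge0.
under eq_eseriesr => j _ do rewrite (proj2 (iF j))// muleC.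
rewrite -[in RHS](fineK (prod_mean_fin_num _ ff)) muleC measure_semi_bigcup//.
rewrite -nneseriesZl//; apply: eq_eseriesr => j _.
by rewrite fineK// prod_mean_fin_num.
Qed.

Definition window (B : nat -> set R) (c n : nat) :=
  [set w | forall m, (c < m < n)%N -> B m (Y m w)].

Lemma measurable_window B c n : (forall m, measurable (B m)) ->
  measurable (window B c n).
Proof.
move=> mB; rewrite (_ : window B c n =
    \bigcap_(m in [set m | (c < m < n)%N]) (Y m @^-1` B m))//.
by apply: bigcap_measurableType => m _; exact: measurable_preimage.
Qed.

Lemma indic_window (B : nat -> set R) c n w :
  \1_(window B c n) w = \prod_(c.+1 <= m < n) \1_(B m) (Y m w) :> R.
Proof.
rewrite indicE; case: (boolP (_ \in _)) => [/set_mem wB|wB].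
  rewrite big_nat big1// => m mcn; rewrite indicE mem_set//; exact: wB.
have [m mcn wm] : exists2 m, (c < m < n)%N & ~ B m (Y m w).
  apply: contrapT => h; move/negP: wB; apply; apply/mem_set => m mcn.
  by apply: contrapT => nB; apply: h; exists m.
rewrite (bigD1_seq m) ?iota_uniq ?mem_index_iota//=.
by rewrite indicE memNset// mul0r.
Qed.

(** Each constraint on [Y m] is absorbed into the factor [f m] as an indicator, which keeps the mean
    finite; the independence of [A] from the future then applies. *)
Lemma integral_window A B c n f : indep_future A c ->
  (forall m, measurable (B m)) -> (forall m, finite_mean P (Y m) (f m)) ->
  (\int[P]_(w in A `&` window B c n) (\prod_(c.+1 <= m < n) f m (Y m w))%:E =
   P A * \prod_(c.+1 <= m < n) mean m (fun x => f m x * \1_(B m) x)%R)%E.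
Proof.
move=> [mA iA] mB ff; rewrite -(iA n (fun m x => f m x * \1_(B m) x)); last first.
  by move=> m; exact: finite_meanM_indic.
rewrite integral_mkcondr epatch_indic; apply: eq_integral => w _ /=.
by rewrite indic_window -EFinM -big_split.
Qed.

Lemma measure_window A B c n : indep_future A c -> (forall m, measurable (B m)) ->
  (P (A `&` window B c n) = P A * \prod_(c.+1 <= m < n) P (Y m @^-1` B m))%E.
Proof.
move=> iA mB; have := integral_window n iA mB finite_mean1.
under eq_integral do rewrite big1//.
rewrite integral_cst//; last first.
  by apply: measurableI; [case: iA|exact: measurable_window].
rewrite mul1e => ->; congr (_ * _)%E; apply: eq_bigr => m _.
by under eq_integral do rewrite mul1r; rewrite integral_indic_preimage.
Qed.

(** The constraints up to [e] and the functions after [e] are merged into one window up to [n]: the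
    function is 1 on the first range, the constraint is [setT] on the second. The product given by
    [integral_window] then splits at [e.+1], and its lower half is the probability of the original
    window. *)
Lemma indep_future_window A B c e : indep_future A c ->
  (forall m, measurable (B m)) -> (c <= e)%N ->
  indep_future (A `&` window B c e.+1) e.
Proof.
move=> iA mB ce.
have mAw : measurable (A `&` window B c e.+1).
  by apply: measurableI; [case: iA|exact: measurable_window].
split=> // n f ff; have [en|ne] := ltnP e n; last first.
  rewrite big_geq; last exact: leqW.
  under eq_integral do rewrite big_geq ?leqW//.
  by rewrite integral_cst// mul1e mule1.
pose f' m := if (m <= e)%N then cst 1 else f m.
pose B' m := if (m <= e)%N then B m else setT.
have ff' m : finite_mean P (Y m) (f' m).
  by rewrite /f'; case: ifP => _ //; exact: finite_mean1.
have mB' m : measurable (B' m) by rewrite /B'; case: ifP.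
have -> : window B c e.+1 = window B' c n.
  apply/seteqP; split=> w /= wB m /andP[cm mn].
    by rewrite /B'; case: ifPn => // me; apply: wB; rewrite cm ltnS.
  have me : (m <= e)%N by [].
  by have := wB m; rewrite /B' me cm; apply; exact: leq_ltn_trans me en.
have lo (U : Type) (u v : U) m :
    (c < m < e.+1)%N -> (if (m <= e)%N then u else v) = u.
  by case/andP => _; rewrite ltnS => ->.
have hi (U : Type) (u v : U) m :
    (e < m < n)%N -> (if (m <= e)%N then u else v) = v.
  by case/andP; rewrite ltnNge => /negbTE ->.
transitivity (\int[P]_(w in A `&` window B' c n)
    (\prod_(c.+1 <= m < n) f' m (Y m w))%:E)%E.
  apply: eq_integral => w _; congr (_%:E).
  rewrite [RHS](big_cat_nat (n := e.+1))//= [X in _ = X * _]big_nat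
    [X in _ = X * _]big1 ?mul1r.
    by apply: eq_big_nat => m emn; rewrite /f' hi.
  by move=> m cme; rewrite /f' lo.
rewrite (integral_window n iA mB' ff') measure_window// -muleA.
rewrite !(big_cat_nat (n := e.+1) (m := c.+1) (p := n))//= -muleA.
congr (_ * (_ * _))%E; last rewrite [X in _ = (X * _)%E]big_nat
  [X in _ = (X * _)%E]big1 ?mul1e.
- apply: eq_big_nat => m cme; rewrite /f' /B' !lo//.
  by under eq_integral do rewrite mul1r; rewrite integral_indic_preimage.
- apply: eq_big_nat => m emn; rewrite /f' /B' !hi// indicT.
  by apply: eq_integral => w _; rewrite mulr1.
- by move=> m emn; rewrite /B' hi// preimage_setT probability_setT.
Qed.
Lemma indep_future_null A B N c : measurable B -> measurable N -> P N = 0 ->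
  A `\` N = B `\` N -> indep_future A c -> indep_future B c.
Proof.
move=> mB mN N0 AB [mA iA].
have eqint (h : T -> R) : measurable_fun setT h -> (forall w, 0 <= h w) ->
    (\int[P]_(w in A) (h w)%:E = \int[P]_(w in B) (h w)%:E)%E.
  by move=> mh h0; exact: (integral_eq_null mA mB mN).
split=> // n f ff; rewrite -eqint; [|exact: measurable_prod_comp|]; last first.
  by move=> w; exact: prod_comp_ge0.
rewrite iA//; congr (_ * _)%E.
have /= := eqint (cst 1) (measurable_cst _) (fun=> ler01).
by rewrite !integral_cst// !mul1e.
Qed.
End independence.

(** * Exponential law and geometric series *)

Lemma exponential_prob_itvNyc (R : realType) (r x : R) : 0 < x ->
  exponential_prob r `]-oo, x] = (1 - expR (- r * x))%:E.
Proof.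
move=> x0; rewrite EFinB -exponential_prob_itv0c// /exponential_prob.
rewrite integral_mkcond [RHS]integral_mkcond; apply: eq_integral => y _.
rewrite !patchE !mem_setE !in_itv/=.
have [y0|y0] := leP 0 y; first by [].
by rewrite lt0_exponential_pdf//; case: ifP.
Qed.

(** Exponential tilting: multiplying the density of Exp([lam]) by exp(-s x) gives [lam / (lam + s)]
    times the density of Exp([lam + s]). *)
Lemma exponential_transform (d : measure_display) (T : measurableType d)
  (R : realType) (P : probability T R) (V : T -> R) (lam s : R) (B : set R) :
  0 < lam -> 0 <= s -> measurable_fun setT V ->
  (forall B, measurable B -> P (V @^-1` B) = exponential_prob lam B) ->
  measurable B ->
  (\int[P]_w (expR (- s * V w) * \1_B (V w))%:E =
   (lam / (lam + s))%:E * exponential_prob (lam + s) B)%E.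
Proof.
move=> lam0 s0 mV law mB.
have ls0 : 0 < lam + s by rewrite ltr_wpDr.
pose h x : R := expR (- s * x) * \1_B x.
have mh : measurable_fun setT h.
  apply: measurable_funM; last exact: measurable_indic.
  by apply: measurableT_comp => //; exact: measurable_funM.
have h0 x : 0 <= h x by rewrite mulr_ge0 ?expR_ge0// indicE ler0n.
transitivity (\int[pushforward P V]_x (h x)%:E)%E.
  rewrite (ge0_integral_pushforward mV)//; first exact/measurable_EFinP.
  by move=> x _; rewrite lee_fin.
(* The factor 1 is the constant [c] of the transport lemma, used here with the density as weight to
   pass from the law of [V] to Lebesgue measure. *)
rewrite -[LHS]mul1e.
rewrite (ge0_integral_transport (mu := @lebesgue_measure R)
  (nu := pushforward P V) (Y := id) (Z := exponential_pdf lam))//; last 3 first.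
- exact: measurable_exponential_pdf.
- by move=> x; apply: exponential_pdf_ge0; exact: ltW.
- by move=> C mC; rewrite mul1e; exact: law.
rewrite /exponential_prob -ge0_integralZl_EFin//; last 3 first.
- by move=> x _; rewrite lee_fin exponential_pdf_ge0// ltW.
- apply/measurable_EFinP; apply: measurable_funTS.
  exact: measurable_exponential_pdf.
- by rewrite divr_ge0// ltW.
rewrite [RHS]integral_mkcond; apply: eq_integral => x _.
rewrite patchE /h indicE; case: ifPn => xB; last by rewrite mulr0 mul0r.
rewrite mulr1; have [x0|x0] := leP 0 x; last first.
  by rewrite !lt0_exponential_pdf// mulr0 mule0.
rewrite !exponential_pdfE// -EFinM; congr (_%:E).
rewrite mulrCA mulrA -mulrA -expRD mulrA divfK ?gt_eqF//.
by congr (_ * expR _); rewrite opprD mulrDl addrC.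
Qed.

Lemma nneseries_geometric (R : realType) (x y : R) : 0 <= y < 1 -> 0 <= x ->
  (\sum_(0 <= k <oo) (x * y ^+ k)%:E = (x / (1 - y))%:E)%E.
Proof.
move=> /andP[y0 y1] x0; apply/cvg_lim => //.
under eq_fun do rewrite sumEFin.
apply: cvg_EFin; first by near=> k.
by apply: cvg_geometric_series; rewrite ger0_norm.
Unshelve. all: by end_near.
Qed.

(** With [u = expR ((lam + s) * eps)] the numerator is [u^-1], and the denominator is
    [(lam + s * u) / ((lam + s) * u)]. *)
Lemma geometric_value (R : realType) (lam eps s : R) : 0 < lam -> 0 <= s ->
  expR (- s * eps) * expR (- lam * eps) /
    (1 - lam / (lam + s) * (1 - expR (- (lam + s) * eps))) =
  (lam + s) / (lam + s * expR ((lam + s) * eps)).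
Proof.
move=> lam0 s0; have ls0 : 0 < lam + s by rewrite ltr_wpDr.
pose u := expR ((lam + s) * eps); have u0 : 0 < u by exact: expR_gt0.
have -> : expR (- s * eps) * expR (- lam * eps) = u^-1.
  by rewrite -expRD -expRN; congr expR; ring.
rewrite mulNr expRN -/u.
have d0 : 0 < lam + s * u by rewrite ltr_pwDl// mulr_ge0// ltW.
by field; rewrite !gt_eqF.
Qed.

(** * The end of a cluster as the first big gap *)

Lemma next_end_ge (R : realType) (x : nat -> R) eps c : (c <= next_end x eps c)%N.
Proof. by rewrite /next_end; case: pselect => // h; rewrite leq_addr. Qed.

Lemma next_end_none (R : realType) (x : nat -> R) eps c :
  (forall k, ~~ big_gap x eps (c + k)%N) -> next_end x eps c = c.
Proof.
by move=> nb; rewrite /next_end; case: pselect => // h; exfalso;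
case: h => k bk; move: (nb k); rewrite bk.
Qed.

(** The existence hypothesis excludes the default value, which would give [l = c] without a big gap
    at [c]. *)
Lemma next_endP (R : realType) (x : nat -> R) eps c l : (c <= l)%N ->
  (exists k, big_gap x eps (c + k)%N) ->
  next_end x eps c = l <->
  big_gap x eps l /\ forall m, (c <= m < l)%N -> ~~ big_gap x eps m.
Proof.
move=> cl ex; rewrite /next_end; case: pselect => // h.
case: ex_minnP => k bk0 kmin0.
have bk : big_gap x eps (c + k)%N := bk0.
have kmin m : big_gap x eps (c + m)%N -> (k <= m)%N := kmin0 m.
split=> [<-|[bl nb]].
  split=> // m /andP[cm mk]; apply/negP => bm.
  have /kmin : big_gap x eps (c + (m - c))%N by rewrite subnKC.
  by rewrite leqNgt ltn_subLR// mk.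
apply/eqP; rewrite eqn_leq; apply/andP; split.
  by rewrite -leq_subRL//; apply: kmin; rewrite subnKC.
rewrite leqNgt; apply/negP => kl.
by have := nb (c + k)%N; rewrite leq_addr kl bk => /(_ isT).
Qed.

Lemma measurable_interarrival (d : measure_display) (T : measurableType d)
  (R : realType) (X : nat -> T -> R) m : (forall n, measurable_fun setT (X n)) ->
  measurable_fun setT (interarrival X m).
Proof. by case: m => [|m] mX; [exact: mX|exact: measurable_funB]. Qed.

(** * Cluster boundaries of the Poisson process *)

Section clusters.
Context (d : measure_display) (T : measurableType d) (R : realType).
Variables (P : probability T R) (lam eps : R) (X : nat -> T -> R).
Hypotheses (lam0 : 0 < lam) (eps0 : 0 < eps) (poissonX : poisson_process P lam X).

Let mX n : measurable_fun setT (X n). Proof. by case: poissonX. Qed.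
Local Notation G := (interarrival X).
Let mG m : measurable_fun setT (G m).
Proof. exact: measurable_interarrival. Qed.
Let lawG m B : measurable B -> P (G m @^-1` B) = exponential_prob lam B.
Proof. by case: poissonX => _ [+ _]; exact. Qed.
Let iG : mutually_independent P G. Proof. by case: poissonX => _ []. Qed.

Let path w n := X n w.

Definition end_set c l := [set w | next_end (path w) eps c = l].
Definition start_set i c := [set w | cluster_start (path w) eps i = c].
(** This is exactly the event on which [next_end] from [c] falls back on its default value. *)
Definition no_gap_set c := [set w | forall k, ~~ big_gap (path w) eps (c + k)%N].

(* The gap following the point [m] is [G m.+1], so [window (end_range l) c l.+2]
   says that [l] is the first index from [c] on with a big gap. *)
Definition end_range l m : set R :=
  if (m <= l)%N then `]-oo, eps]%classic else `]eps, +oo[%classic.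

Lemma measurable_end_range l m : measurable (end_range l m).
Proof. by rewrite /end_range; case: ifP. Qed.

Lemma measurable_no_gap_set c : measurable (no_gap_set c).
Proof.
rewrite (_ : no_gap_set c = \bigcap_k (G (c + k).+1 @^-1` `]-oo, eps]%classic)).
  by apply: bigcapT_measurable => k; exact: measurable_preimage.
apply/seteqP; split=> w /= h k.
  by move=> _; rewrite /= in_itv/= leNgt; exact: h.
by have := h k I; rewrite /= in_itv/= leNgt.
Qed.

Let p : R := 1 - expR (- lam * eps).

(** For every [k] the event forces the [k] gaps after the point [c] to be at most [eps], which has
    probability [p ^+ k] with [p < 1]. *)
Lemma no_gap_set_null c : P (no_gap_set c) = 0.
Proof.
have p01 : 0 <= p < 1.
  rewrite subr_ge0 -[leRHS]expR0 ler_expR mulNr oppr_le0 mulr_ge0 ?ltW//=.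
  by rewrite ltrBlDr ltrDl expR_gt0.
have le k : (P (no_gap_set c) <= (p ^+ k)%:E)%E.
  have -> : ((p ^+ k)%:E = P (window G (fun=> `]-oo, eps]%classic) c (c.+1 + k)))%E.
    rewrite -[X in P X]setTI (measure_window mG)//; last exact: indep_futureT.
    rewrite probability_setT mul1e.
    under eq_bigr do rewrite lawG// exponential_prob_itvNyc//.
    by rewrite prodEFin prodr_const_nat addKn.
  apply: le_measure; rewrite ?inE.
  - exact: measurable_no_gap_set.
  - exact: measurable_window.
  - move=> w h m /andP[cm _]; rewrite /= in_itv/= leNgt.
    by case: m cm => // m; rewrite ltnS => cm; have := h (m - c)%N; rewrite subnKC.
apply/eqP; rewrite eq_le measure_ge0 andbT.
have cv : ((p ^+ k)%:E @[k --> \oo] --> 0%:E)%E.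
  apply: cvg_EFin; first by near=> k.
  by apply: cvg_expr; case/andP: p01 => ? ?; rewrite ger0_norm.
have <- : (limn (fun k => (p ^+ k)%:E) = 0)%E by exact: cvg_lim cv.
apply: lime_ge; first by apply/cvg_ex; exists 0%:E.
by apply: nearW.
Unshelve. all: by end_near.
Qed.

(** Off the null event a big gap exists, so [next_endP] applies; what remains is the index shift
    between the point [m] and the gap [G m.+1] that follows it. *)
Lemma end_setD_null c l : (c <= l)%N ->
  window G (end_range l) c l.+2 `\` no_gap_set c = end_set c l `\` no_gap_set c.
Proof.
move=> cl; apply/seteqP; split=> w [h ng]; split=> //;
  have ex : exists k, big_gap (path w) eps (c + k)%N
    by apply: contrapT => ne; apply: ng => k; apply/negP => bk; apply: ne; exists k.
  apply/(next_endP cl ex); split.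
    have := h l.+1; rewrite /end_range ltnn /= in_itv/= andbT; apply.
    by rewrite !ltnS leqnn cl.
  move=> m /andP[cm ml]; rewrite /big_gap -leNgt.
  have := h m.+1; rewrite /end_range ml /= in_itv/=; apply.
  by rewrite !ltnS cm ltnW.
move/(next_endP cl ex): h => [bl nb] [//|m] /andP[cm ml].
rewrite /end_range; case: ifPn => [lm|]; rewrite /= in_itv/= ?andbT.
  by rewrite leNgt; apply: nb; rewrite -ltnS cm.
rewrite -leqNgt => lm.
have -> : m = l by apply/eqP; rewrite eqn_leq -ltnS -[(m < _)%N]ltnS ml -ltnS.
exact: bl.
Qed.

Lemma end_set_lt c l : (l < c)%N -> end_set c l = set0.
Proof.
move=> lc; apply/seteqP; split=> // w /= e.
by have := next_end_ge (path w) eps c; rewrite e leqNgt lc.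
Qed.

(** Off [no_gap_set c] the event is a window. On [no_gap_set c] the end is [c] by default, so that
    part is all of [no_gap_set c] if [l = c] and empty otherwise. *)
Lemma measurable_end_set c l : measurable (end_set c l).
Proof.
have mN := measurable_no_gap_set c.
have [cl|lc] := leqP c l; last first.
  by rewrite end_set_lt.
rewrite -(setUIDK (end_set c l) (no_gap_set c)) -end_setD_null//.
apply: measurableU.
  have [->|/eqP lc] := eqVneq l c.
    rewrite setIidr// => w h; exact: next_end_none.
  rewrite (_ : _ `&` _ = set0)//; apply/seteqP; split=> // w [/= el nw].
  by apply: lc; rewrite -el next_end_none.
apply: measurableD => //; apply: measurable_window => //.
exact: measurable_end_range.
Qed.

(** Recognizing the end [l] uses the gaps up to [G l.+1] inclusive, so independence persists only
    after [l.+1], the first point of the next cluster. *)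
Lemma indep_future_end_set A c l : (c <= l)%N -> indep_future P G A c ->
  indep_future P G (A `&` end_set c l) l.+1.
Proof.
move=> cl iA; have mA : measurable A by case: iA.
apply: (indep_future_null mG (A := A `&` window G (end_range l) c l.+2)
  _ (measurable_no_gap_set c)).
- by apply: measurableI => //; exact: measurable_end_set.
- exact: no_gap_set_null.
- by rewrite -!setIDA -end_setD_null.
- apply: indep_future_window => //; first exact: measurable_end_range.
  exact: leqW.
Qed.

Lemma start_set_succ i l :
  start_set i.+1 l.+1 = \bigcup_c (start_set i c `&` end_set c l).
Proof.
apply/seteqP; split=> w /=.
  by move=> [e]; exists (cluster_start (path w) eps i).
by move=> [c _ [/= <- <-]].
Qed.

Lemma trivIset_start_set i : trivIset setT (start_set i).
Proof.
apply/trivIsetP => l k _ _ /eqP lk; apply/seteqP; split=> // w [/= el ek].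
by apply: lk; rewrite -el.
Qed.

(** Stopping-time property, by induction on [i]: the event is split over the disjoint starts of the
    preceding cluster, and each piece is handled by [indep_future_end_set]. *)
Lemma indep_future_start_set i c : indep_future P G (start_set i c) c.
Proof.
elim: i c => [|i IH] c.
  have [->|/eqP c0] := eqVneq c 0%N.
    rewrite (_ : start_set 0 0 = setT); first exact: indep_futureT.
    by apply/seteqP; split.
  rewrite (_ : start_set 0 c = set0); first exact: indep_future0.
  by apply/seteqP; split=> // w /= /esym.
case: c => [|l].
  rewrite (_ : start_set _ _ = set0); first exact: indep_future0.
  by apply/seteqP; split.
rewrite start_set_succ; apply: indep_future_bigcup => //.
  apply/trivIsetP => j k _ _ /eqP jk; apply/seteqP; split=> // w.
  by move=> [[/= ej _] [ek _]]; apply: jk; rewrite -ej.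
move=> j; have [jl|lj] := leqP j l; first exact: indep_future_end_set.
by rewrite end_set_lt// setI0; exact: indep_future0.
Qed.

(** * Laplace transform of the cluster length *)

Variable s : R.
Hypothesis s0 : 0 <= s.

(* [ratio] is the mean of exp(-s G) over {G <= eps} for an Exp(lam) gap [G], and
   [weight] is exp(-s eps) times the probability of {eps < G}. *)
Let ratio : R := lam / (lam + s) * (1 - expR (- (lam + s) * eps)).
Let weight : R := expR (- s * eps) * expR (- lam * eps).

Lemma ratio_ge0_lt1 : 0 <= ratio < 1.
Proof.
have ls0 : 0 < lam + s by rewrite ltr_wpDr.
have e0 : 0 <= 1 - expR (- (lam + s) * eps).
  by rewrite subr_ge0 -[leRHS]expR0 ler_expR mulNr oppr_le0 mulr_ge0 ?ltW.
have r0 : 0 <= lam / (lam + s) by rewrite divr_ge0// ltW.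
apply/andP; split; first exact: mulr_ge0.
apply: (@le_lt_trans _ _ (1 - expR (- (lam + s) * eps))); last first.
  by rewrite ltrBlDr ltrDl expR_gt0.
by rewrite ler_piMl// ler_pdivrMr// mul1r lerDl.
Qed.

Lemma expR_increments c k w :
  \prod_(c.+1 <= m < (c + k).+1) expR (- s * G m w) =
  expR (- s * (X (c + k)%N w - X c w)).
Proof.
elim: k => [|k IH]; first by rewrite addn0 big_geq// subrr mulr0 expR0.
rewrite addnS big_nat_recr/=; last by rewrite ltnS leq_addr.
rewrite IH -expRD; congr expR; rewrite -mulrDr; congr (_ * _).
by rewrite addrC addrA subrK.
Qed.

Lemma finite_mean_expR m : finite_mean P (G m) (fun x => expR (- s * x)).
Proof.
split=> [|x|]; first by apply: measurableT_comp => //; exact: measurable_funM.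
  exact: expR_ge0.
have := exponential_transform lam0 s0 (mG m) (@lawG m) measurableT.
under eq_integral do rewrite indicT mulr1.
move=> ->; rewrite fin_numM// /exponential_prob integral_exponential_pdf//.
by rewrite ltr_wpDr.
Qed.

(** On this event the length is a sum of [k] gaps, each at most [eps] and contributing [ratio], plus
    [eps]. The closing gap enters only through the probability that it exceeds [eps]. *)
Lemma integral_cell A c k : indep_future P G A c ->
  (\int[P]_(w in A `&` end_set c (c + k)%N)
     (expR (- s * (X (c + k)%N w + eps - X c w)))%:E =
   P A * (weight * ratio ^+ k)%:E)%E.
Proof.
move=> iA; have mA : measurable A by case: iA.
set l := (c + k)%N; have cl : (c <= l)%N := leq_addr _ _.
(* The gap [G l.+1] closes the cluster without counting in its length, hence the factor 1 there. *)
pose f m : R -> R := if (m <= l)%N then fun x => expR (- s * x) else cst 1.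
have ff m : finite_mean P (G m) (f m).
  by rewrite /f; case: ifP => _; [exact: finite_mean_expR|exact: finite_mean1].
have mr := measurable_end_range.
have fE w : expR (- s * (X l w + eps - X c w)) =
    expR (- s * eps) * \prod_(c.+1 <= m < l.+2) f m (G m w).
  rewrite big_nat_recr//= {2}/f ltnn mulr1.
  rewrite (eq_big_nat _ _ (F2 := fun m => expR (- s * G m w))); last first.
    by move=> m /andP[_]; rewrite ltnS /f => ->.
  rewrite expR_increments -expRD -mulrDr; congr (expR (_ * _)).
  by rewrite [RHS]addrC -[RHS]addrA [- _ + _]addrC addrA.
have -> : (\int[P]_(w in A `&` end_set c l)
      (expR (- s * (X l w + eps - X c w)))%:E =
    \int[P]_(w in A `&` window G (end_range l) c l.+2)
      (expR (- s * (X l w + eps - X c w)))%:E)%E.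
  apply: (integral_eq_null (N := no_gap_set c)).
  - by apply: measurableI => //; exact: measurable_end_set.
  - by apply: measurableI => //; exact: measurable_window.
  - exact: measurable_no_gap_set.
  - exact: no_gap_set_null.
  - by rewrite -!setIDA end_setD_null.
  - apply: measurableT_comp => //; apply: measurable_funM => //.
    by apply: measurable_funB => //; exact: measurable_funD.
  - by move=> w; exact: expR_ge0.
under eq_integral do rewrite fE EFinM.
rewrite ge0_integralZl_EFin ?expR_ge0//; first last.
- by apply/measurable_EFinP; apply: measurable_funTS; exact: measurable_prod_comp.
- by move=> w _; rewrite lee_fin; exact: prod_comp_ge0.
- by apply: measurableI => //; exact: measurable_window.
rewrite (integral_window mG)// muleCA; congr (_ * _)%E.
rewrite big_nat_recr//=.
rewrite (eq_big_nat _ _ (F2 := fun=> ratio%:E)); last first.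
  move=> m /andP[_]; rewrite ltnS /f /end_range => ->.
  rewrite (exponential_transform lam0 s0)//; last exact: lawG.
  by rewrite exponential_prob_itvNyc.
rewrite prodEFin prodr_const_nat subSS addKn.
have -> : (\int[P]_w (f l.+1 (G l.+1 w) * \1_(end_range l l.+1) (G l.+1 w))%:E =
    (expR (- lam * eps))%:E)%E.
  rewrite /f /end_range ltnn.
  under eq_integral do rewrite mul1r.
  rewrite integral_indic_preimage//.
  rewrite (_ : _ @^-1` _ = ~` (G l.+1 @^-1` `]-oo, eps]%classic)); last first.
    by apply/seteqP; split=> w; rewrite /= !in_itv/= andbT ltNge => /negP.
  rewrite probability_setC; last exact: measurable_preimage.
  by rewrite lawG// exponential_prob_itvNyc// -EFinB opprB addrC subrK.
by rewrite -!EFinM mulrCA mulrC.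
Qed.

Lemma start_set_end_set i c :
  start_set i c = \bigcup_k (start_set i c `&` end_set c (c + k)%N).
Proof.
apply/seteqP; split=> w /=; last by case=> k _ [].
move=> wc; exists (next_end (path w) eps c - c)%N => //; split=> //=.
by rewrite subnKC//; exact: next_end_ge.
Qed.

Lemma bigcup_start_set i : \bigcup_c start_set i c = setT.
Proof. by apply/seteqP; split=> w // _; exists (cluster_start (path w) eps i). Qed.

Lemma clusterB_cell i c k w : (start_set i c `&` end_set c (c + k)%N) w ->
  clusterB (path w) eps i.+1 = X (c + k)%N w + eps - X c w.
Proof.
by case=> <- <-.
Qed.

(** The cells indexed by the first point [c] of the cluster and the number [k] of further points
    partition the space. The sum over [k] is geometric. *)
Lemma laplace_clusterB i :
  (\int[P]_w (expR (- s * clusterB (path w) eps i.+1))%:E =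
   (weight / (1 - ratio))%:E)%E.
Proof.
have [a0 a1] := andP ratio_ge0_lt1.
have b0 : 0 <= weight by rewrite mulr_ge0 ?expR_ge0.
pose h w := (expR (- s * clusterB (path w) eps i.+1))%:E.
have h0 w : (0 <= h w)%E by rewrite lee_fin expR_ge0.
have mS c : measurable (start_set i c) by case: (indep_future_start_set i c).
have mC c k : measurable (start_set i c `&` end_set c (c + k)%N).
  by apply: measurableI => //; exact: measurable_end_set.
(* The indices of the first and last points are random, but constant on each cell; measurability of
   [h] is therefore proved on cells and glued over their countable union. *)
have mhC c k : measurable_fun (start_set i c `&` end_set c (c + k)%N) h.
  apply: (@eq_measurable_fun _ _ _ _ _
    (fun w => (expR (- s * (X (c + k)%N w + eps - X c w)))%:E)).
    by move=> w /set_mem wC; rewrite /h (clusterB_cell wC).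
  apply: measurable_funTS; apply/measurable_EFinP.
  apply: measurableT_comp => //; apply: measurable_funM => //.
  by apply: measurable_funB => //; exact: measurable_funD.
have mhS c : measurable_fun (start_set i c) h.
  by rewrite start_set_end_set; apply/measurable_fun_bigcup.
rewrite -[X in integral _ X](bigcup_start_set i) ge0_integral_bigcup//.
- transitivity (\sum_(0 <= c <oo) ((weight / (1 - ratio))%:E *
      P (start_set i c)))%E.
    apply: eq_eseriesr => c _.
    rewrite [X in integral _ X]start_set_end_set ge0_integral_bigcup//.
    + transitivity (\sum_(0 <= k <oo) (P (start_set i c) *
          (weight * ratio ^+ k)%:E))%E.
        apply: eq_eseriesr => k _.
        rewrite -(integral_cell k (indep_future_start_set i c)).
        by apply: eq_integral => w /set_mem wC; rewrite (clusterB_cell wC).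
      have Pfin : P (start_set i c) \is a fin_num by rewrite fin_num_measure.
      rewrite -(fineK Pfin) nneseriesZl; last first.
        by move=> k _; rewrite lee_fin mulr_ge0// exprn_ge0.
      by rewrite nneseries_geometric ?ratio_ge0_lt1// muleC.
    + by rewrite -start_set_end_set.
    + apply/trivIsetP => j k _ _ /eqP jk; apply/seteqP; split=> // w.
      by move=> [[/= _ ej] [_ ek]]; apply: jk; apply/(@addnI c); rewrite -ej -ek.
  (* The inner series has given the same factor for every start [c], so only the total probability
     of the starts is left, which is 1. *)
  rewrite nneseriesZl// -measure_semi_bigcup//.
  + rewrite bigcup_start_set -[RHS]mule1; congr (_ * _)%E.
    exact: probability_setT.
  + exact: trivIset_start_set.
  + by rewrite bigcup_start_set.
- by apply/measurable_fun_bigcup.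
- exact: trivIset_start_set.
Qed.

End clusters.

Theorem theorem1 (d : measure_display) (T : measurableType d) (R : realType)
  (P : probability T R) (lam eps : R) (X : nat -> T -> R) :
  0 < lam -> 0 < eps -> poisson_process P lam X ->
  forall (i : nat) (s : R), (0 < i)%N -> 0 <= s ->
  ('E_P[fun w => expR (- s * clusterB (fun n => X n w) eps i)] =
   ((lam + s) / (lam + s * expR ((lam + s) * eps)))%:E)%E.
Proof.
move=> lam0 eps0 pX [//|i] s _ s0.
by rewrite expectation.unlock (laplace_clusterB lam0 eps0 pX)// geometric_value.
Qed.
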